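(* Let $G$ be a graph on $n\ge 7$ vertices such that the $4$-cycle $C_4$ is not a subgraph of the complement $\overline{G}$. If the edges of $G$ are colored red and blue, then there exist two vertex-disjoint monochromatic paths of different colors which together cover at least $n-1$ vertices of $G$.
   Context: $\overline{G}$ denotes the complement of $G$. Convention: the empty graph and a single vertex are accepted as paths of any color, and a single edge is a path in its own color. *)

(* Defs.v *)
From mathcomp Require Import all_boot.

Set Implicit Arguments.
Unset Strict Implicit.
Unset Printing Implicit Defensive.

Definition simple_graph (T : finType) (e : rel T) : Prop :=
  symmetric e /\ irreflexive e.

Definition compl_graph (T : finType) (e : rel T) : rel T :=
  [rel x y | (x != y) && ~~ e x y].

(* Containment is as a not necessarily induced subgraph. [ucycleb] requires
   four distinct vertices, with cyclically consecutive ones adjacent. *)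
Definition has_C4 (T : finType) (e : rel T) : Prop :=
  exists2 s : seq T, size s = 4 & ucycleb e s.

Definition color := bool.
Definition red : color := true.
Definition blue : color := false.

(* An edge xy is the unordered pair [set x; y]. Colorings are total functions
   on sets of vertices, but only their values on edges of e are ever used. *)
Definition edge_coloring (T : finType) := {set T} -> color.

Definition color_class (T : finType) (e : rel T) (c : edge_coloring T)
    (a : color) : rel T :=
  [rel x y | e x y && (c [set x; y] == a)].

(* A path is the list of its distinct vertices in order; the empty list and
   one-vertex lists are thus monochromatic paths of both colors. *)
Definition monochromatic_path (T : finType) (e : rel T) (c : edge_coloring T)
    (a : color) (p : seq T) : bool :=
  sorted (color_class e c a) p && uniq p.

(* Main.v *)
(* Among the pairs of disjoint paths, p red and q blue, take one that covers the
   most vertices and, among those, has p longest. Suppose two vertices are left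
   uncovered. Look only at a window of at most eight vertices: one or two at
   each end of p and of q (all of a path if it is short) and two uncovered ones,
   or three, which exist if p and q are short since n >= 7. Every pair
   in the window is a red edge, a blue edge or a non-edge. The four pairs of a
   4-cycle are not all non-edges, and the window cannot contain the edges needed
   to reroute the paths into a better pair in which the hidden middles of p and q
   are kept as blocks. These constraints, read as clauses, are jointly
   unsatisfiable, which is decided by branching on the state of one pair at a
   time. *)

Require Import Defs.
From mathcomp Require Import all_boot zify.

Set Implicit Arguments.
Unset Strict Implicit.
Unset Printing Implicit Defensive.

(** * Refuting a set of clauses by branching *)

Section Refutation.

Variables (V A : eqType) (values : seq A).

(* A clause is a list of pairs (variable, value) read as a conjunction that
   leads to the goal, so an empty clause closes the branch. *)
Definition assign (x : V) (a : A) (cls : seq (seq (V * A))) :=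
  [seq [seq l <- cl | l.1 != x]
     | cl <- cls & all (fun l => (l.1 == x) ==> (l.2 == a)) cl].

(** [refute] calls this only when no clause is empty, so [[::]] can stand for no clause found yet.
    Branching on a variable of a shortest clause is a heuristic that keeps the search tree small. *)
Definition shortest (cls : seq (seq (V * A))) :=
  foldr
    (fun cl best => if nilp best || (size cl <= size best) then cl else best)
    [::] cls.

Fixpoint refute (fuel : nat) (cls : seq (seq (V * A))) : bool :=
  if has (fun cl => nilp cl) cls then true
  else if fuel is k.+1 then
    if shortest cls is (x, _) :: _ then
      all (fun a => refute k (assign x a cls)) values
    else false
  else false.

Variables (f : V -> A) (G : Prop).
Hypothesis f_values : forall x, f x \in values.

Definition entails_goal (cls : seq (seq (V * A))) : Prop :=
  forall cl, cl \in cls -> all (fun l => f l.1 == l.2) cl -> G.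

(** The literals deleted by [assign] are true, since [f x = a]. Hence a surviving clause holds under
    [f] as soon as its remainder does. *)
Lemma entails_assign x a cls :
  f x = a -> entails_goal cls -> entails_goal (assign x a cls).
Proof.
move=> fx clsG cl' /mapP[cl].
rewrite mem_filter => /andP[/allP cla clin] -> clf.
apply: clsG clin _; apply/allP => l lcl.
have [lx|lx] := eqVneq l.1 x.
  by have := cla _ lcl; rewrite lx eqxx fx eq_sym.
by apply: (allP clf); rewrite mem_filter lx.
Qed.

(** Follow the one branch that takes the true value [f x] each time. Its clauses keep entailing [G],
    and it ends in an empty clause, which holds vacuously. *)
Lemma refuteP fuel cls : refute fuel cls -> entails_goal cls -> G.
Proof.
elim: fuel cls => [|k IHk] cls /=;
  case: hasP => [[cl clin /nilP cl0] _ clsG|_] //.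
- by apply: clsG clin _; rewrite cl0.
- by apply: clsG clin _; rewrite cl0.
case: (shortest cls) => [|[x a] _] // /allP/(_ _ (f_values x)) ref_k clsG.
exact: IHk ref_k (entails_assign erefl clsG).
Qed.

End Refutation.

(** * Exchanging the ends of a path *)

Section PathRealization.

Variables (T : Type) (r : rel T).

(** The equation on [last] is automatic for empty [l'] and otherwise says that [l'] ends like [l].
    So [s] either begins the new list or keeps its left neighbour. *)
Lemma sorted_cat_replace_left (x0 : T) l l' s :
  l <> [::] -> sorted r (l ++ s) -> sorted r l' ->
  last (last x0 l) l' = last x0 l ->
  sorted r (l' ++ s).
Proof.
case: l => [|a l] // _; rewrite /= cat_path => /andP[_ rs].
case: l' => [|a' l'] /=; first by move=> _ _; apply: path_sorted rs.
by rewrite cat_path => -> ->.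
Qed.

(** Mirror image: the default value of [head] makes the last hypothesis automatic for empty [t']. *)
Lemma sorted_cat_replace_right (x : T) s t t' :
  sorted r (s ++ x :: t) -> sorted r t' -> head x t' = x -> sorted r (s ++ t').
Proof.
case: t' => [|x' t'] /=; first by rewrite cats0 => /cat_sorted2[].
move=> + + ex; rewrite ex; case: s => [|a s] //=.
by rewrite !cat_path /= => /and3P[-> -> _] ->.
Qed.

End PathRealization.

(** * Windows and their encoding as clauses *)

(* The visible labels at the two ends of a path, with an unspecified, possibly
   empty, block of hidden vertices in between. If the second component is empty,
   there is no block and the first component is the whole path. *)
Definition ends := (seq nat * seq nat)%type.

(* The red path, then the blue one. *)
Definition paths := (ends * ends)%type.

(** Ordering the two labels makes an unordered pair a single variable. The value [None] means a
    non-edge. *)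
Definition edge_lits (a : option color) (s : seq nat) :=
  [seq ((minn ij.1 ij.2, maxn ij.1 ij.2), a) | ij <- zip s (behead s)].

Definition paths_lits (K : paths) :=
  edge_lits (Some red) K.1.1 ++ edge_lits (Some red) K.1.2 ++
  edge_lits (Some blue) K.2.1 ++ edge_lits (Some blue) K.2.2.

Definition labels (K : paths) := (K.1.1 ++ K.1.2) ++ (K.2.1 ++ K.2.2).

(* The block between the ends E can be kept when E is replaced by E': its
   neighbours in the new path are the old ones, or it becomes an end. *)
Definition extends_middle (E E' : ends) :=
  if E.2 is y :: _ then
    [&& ~~ nilp E.1, last (last 0 E.1) E'.1 == last 0 E.1 & head y E'.2 == y]
  else nilp E'.2.

Definition lex_lt (k l k' l' : nat) :=
  (k + l < k' + l') || (k + l == k' + l') && (k < k').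

(** Hidden blocks of sizes [b] and [d] lengthen the old and new paths equally, so the visible sizes
    decide the comparison. *)
Lemma lex_ltD b d k1 k2 l1 l2 k1' k2' l1' l2' :
  lex_lt (k1 + k2) (l1 + l2) (k1' + k2') (l1' + l2') ->
  lex_lt (k1 + (b + k2)) (l1 + (d + l2)) (k1' + (b + k2')) (l1' + (d + l2')).
Proof. rewrite /lex_lt; lia. Qed.

Definition improves (m : nat) (K K' : paths) :=
  [&& uniq (labels K'), all (gtn m) (labels K'),
      extends_middle K.1 K'.1, extends_middle K.2 K'.2
    & lex_lt (size (K.1.1 ++ K.1.2)) (size (K.2.1 ++ K.2.2))
             (size (K'.1.1 ++ K'.1.2)) (size (K'.2.1 ++ K'.2.2))].

(* A 4-cycle is determined by its two diagonals. *)
Definition four_cycles (m : nat) : seq (seq nat) :=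
  let pairs := [seq ij <- [seq (i, j) | i <- iota 0 m, j <- iota 0 m]
                  | ij.1 < ij.2] in
  [seq s <- [seq [:: x.1; y.1; x.2; y.2] | x <- pairs, y <- pairs]
     | uniq s && (nth 0 s 0 < nth 0 s 1)].

(** The edges of the given paths [K] are assigned before the search. Each branching eliminates one
    of the fewer than $m^2$ pairs, so the fuel suffices. *)
Definition closed_window (m : nat) (K : paths) (imps : seq paths) :=
  all (improves m K) imps &&
  refute [:: None; Some red; Some blue] (m * m)
    (foldl (fun cls l => assign l.1 l.2 cls)
       ([seq paths_lits K' | K' <- imps] ++
        [seq edge_lits None (rcons s (head 0 s)) | s <- four_cycles m])
       (paths_lits K)).

(** * The eight windows *)

(* Reroutings found by a computer search. A window numbers first the visible
   vertices of the red path, then those of the blue path, then the uncovered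
   ones. *)
Definition long_many : paths := ([:: 0; 1], [:: 2; 3], ([:: 4], [:: 5])).

Definition long_many_improvements : seq paths :=
  [:: ([:: 1], [:: 2; 3], ([:: 6; 0; 4], [:: 5]));
      ([:: 0; 1], [:: 2; 5; 7], ([:: 4], [::]));
      ([:: 1], [::], ([:: 4], [:: 5; 2; 6; 3; 7]));
      ([:: 1], [:: 2; 3], ([:: 7; 0; 4], [:: 5]));
      ([:: 0; 1], [:: 2; 7; 5], ([:: 4], [::]));
      ([:: 0; 1], [:: 2], ([:: 4], [:: 5; 3; 7]));
      ([:: 0; 1], [:: 2], ([:: 4], [:: 5; 3; 6]));
      ([:: 0; 1], [::], ([:: 3; 4], [:: 5; 2; 6]));
      ([:: 7; 4; 1], [:: 2; 3], ([::], [:: 5]));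
      ([::], [:: 2; 3], ([:: 0; 4], [:: 5; 1; 6]));
      ([:: 0; 1], [:: 2; 6; 4], ([::], [:: 5]));
      ([:: 0; 1], [::], ([:: 3; 7; 2; 4], [:: 5]));
      ([::], [:: 2; 3], ([:: 7; 1; 4], [:: 5; 0]));
      ([:: 1], [::], ([:: 7; 0; 6; 2; 4], [:: 5]));
      ([:: 0; 1], [:: 2; 3; 5], ([:: 4], [::]));
      ([:: 0; 1], [:: 2; 6; 5], ([:: 4], [::]));
      ([::], [:: 2; 3], ([:: 0; 4], [:: 5; 1; 7]));
      ([:: 0; 1], [:: 2; 5; 6], ([:: 4], [::]));
      ([:: 0; 1], [:: 2], ([:: 7; 3; 4], [:: 5]));
      ([:: 5; 6; 1], [:: 2; 3], ([:: 4], [::]));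
      ([:: 1], [:: 2; 3], ([:: 4], [:: 5; 0; 7]));
      ([:: 5; 7; 1], [:: 2; 3], ([:: 4], [::]));
      ([:: 7; 5; 1], [:: 2; 3], ([:: 4], [::]));
      ([:: 6; 5; 1], [:: 2; 3], ([:: 4], [::]));
      ([:: 0; 1], [::], ([:: 7; 3; 6; 2; 4], [::]));
      ([:: 0; 1], [::], ([:: 6; 2; 4], [:: 5; 3]));
      ([::], [:: 2; 3], ([:: 0; 7; 1; 4], [:: 5]));
      ([:: 0; 1], [:: 2], ([:: 6; 3; 4], [:: 5]));
      ([:: 6; 4; 1], [:: 2; 3], ([::], [:: 5]));
      ([::], [:: 2; 3], ([:: 0; 6; 1; 4], [:: 5]));
      ([:: 1], [:: 2; 3], ([:: 4], [:: 5; 0; 6]));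
      ([:: 4; 0; 1], [:: 2; 3], ([::], [:: 5]));
      ([:: 1], [::], ([:: 0; 4], [:: 5; 2; 7; 3]));
      ([:: 0; 1], [:: 2; 3; 4], ([::], [:: 5]));
      ([::], [:: 2; 3], ([:: 4], [:: 5; 1; 7; 0]));
      ([:: 4; 6; 1], [:: 2; 3], ([::], [:: 5]));
      ([:: 6; 1], [:: 2; 3], ([:: 0; 4], [:: 5]));
      ([::], [:: 2; 3], ([:: 6; 1; 4], [:: 5; 0]));
      ([::], [:: 2; 3], ([:: 4], [:: 5; 1; 6; 0]));
      ([:: 7; 1], [:: 2; 3], ([:: 0; 4], [:: 5]));
      ([:: 0; 1], [::], ([:: 3; 4], [:: 5; 2; 7]));
      ([:: 0; 1], [::], ([:: 7; 2; 4], [:: 5; 3]));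
      ([:: 5; 0; 1], [:: 2; 3], ([:: 4], [::]));
      ([:: 0; 1], [:: 2; 4; 6], ([::], [:: 5]));
      ([:: 4; 7; 1], [:: 2; 3], ([::], [:: 5]));
      ([:: 0; 1], [:: 2; 3; 7], ([:: 4], [::]));
      ([:: 0; 1], [:: 2; 7], ([:: 4], [:: 5; 3]));
      ([:: 0; 1], [:: 2; 4; 7], ([::], [:: 5]));
      ([:: 0; 1], [:: 2; 6], ([:: 4], [:: 5; 3]));
      ([:: 0; 1], [:: 2; 3; 6], ([:: 4], [::]));
      ([:: 0; 1], [:: 2; 7; 4], ([::], [:: 5]));
      ([:: 6; 0; 1], [:: 2; 3], ([:: 4], [::]));
      ([:: 7; 0; 1], [:: 2; 3], ([:: 4], [::]));
      ([:: 0; 1], [:: 2; 3], ([:: 7; 4], [:: 5]));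
      ([:: 0; 1], [:: 2; 3], ([:: 6; 4], [:: 5]));
      ([:: 0; 1], [:: 2; 3], ([:: 4], [:: 5; 7]));
      ([:: 0; 1], [:: 2; 3], ([:: 4], [:: 5; 6]))].

Lemma long_many_closed : closed_window 8 long_many long_many_improvements.
Proof. by vm_compute. Qed.

(** For one blue vertex and exactly two uncovered ones: $n \ge 7$ then leaves at least four red
    vertices. *)
Definition long_one : paths := ([:: 0; 1], [:: 2; 3], ([:: 4], [::])).

(** An entry with red part [([::], [::])] keeps just the hidden middle as the red path. *)
Definition long_one_improvements : seq paths :=
  [:: ([::], [::], ([:: 0; 2; 4; 1; 6; 3], [::]));
      ([:: 0; 1], [:: 2], ([:: 5; 3; 4], [::]));
      ([::], [::], ([:: 5; 2; 4; 1; 6; 3], [::]));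
      ([:: 3; 0; 1], [::], ([:: 6; 2; 5], [::]));
      ([:: 6; 5; 1], [:: 2; 3], ([::], [::]));
      ([::], [::], ([:: 5; 2; 4; 1; 3; 6], [::]));
      ([::], [::], ([:: 3; 1; 6; 2; 4; 0], [::]));
      ([::], [:: 2; 3], ([:: 5; 1; 6; 0], [::]));
      ([::], [:: 2; 3], ([:: 0; 4; 1; 5], [::]));
      ([::], [:: 2; 0], ([:: 4; 1; 6; 3], [::]));
      ([::], [:: 2; 3; 0], ([:: 5; 1; 6], [::]));
      ([:: 0; 1], [:: 2], ([:: 5; 3; 6], [::]));
      ([:: 1], [:: 2; 3], ([:: 6; 0; 5], [::]));
      ([::], [::], ([:: 3; 4; 1; 5; 2; 6; 0], [::]));
      ([:: 0; 1], [::], ([:: 5; 2; 6; 3], [::]));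
      ([:: 0; 1], [:: 2; 4; 6], ([::], [::]));
      ([:: 0; 1], [:: 2; 4; 5], ([::], [::]));
      ([:: 6; 0; 1], [:: 2; 3], ([::], [::]));
      ([:: 0; 1], [:: 2; 5; 4], ([::], [::]));
      ([:: 4; 1], [:: 2; 3; 0], ([::], [::]));
      ([:: 4; 5; 1], [:: 2; 3], ([::], [::]));
      ([:: 1], [:: 2; 3], ([:: 4; 0; 6], [::]));
      ([::], [::], ([:: 6; 0; 2; 5; 1; 4], [::]));
      ([::], [::], ([:: 4; 0; 2; 6; 1; 5], [::]));
      ([:: 0; 1], [::], ([:: 4; 2; 5; 3], [::]));
      ([:: 0; 1], [::], ([:: 6; 2; 5; 3], [::]));
      ([:: 0; 1], [::], ([:: 3; 4; 2; 6], [::]));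
      ([::], [::], ([:: 3; 5; 1; 4; 2; 6; 0], [::]));
      ([::], [::], ([:: 3; 5; 1; 6; 2; 4], [::]));
      ([:: 3; 0; 1], [::], ([:: 6; 2; 4], [::]));
      ([::], [:: 2; 3], ([:: 6; 1; 4; 0], [::]));
      ([:: 0; 1], [:: 2; 3; 6], ([::], [::]));
      ([:: 0; 1], [:: 2; 3; 5], ([::], [::]));
      ([:: 0; 1], [:: 2; 6; 5], ([::], [::]));
      ([::], [:: 2; 0], ([:: 4; 1; 5; 3], [::]));
      ([::], [::], ([:: 3; 5; 1; 4; 2; 0], [::]));
      ([::], [::], ([:: 0; 2; 5; 1; 6; 3], [::]));
      ([:: 0; 1], [:: 2], ([:: 4; 3; 6], [::]));
      ([:: 0; 1], [:: 2; 5; 6], ([::], [::]));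
      ([:: 0; 1], [:: 2; 5], ([:: 3; 6], [::]));
      ([:: 0; 1], [:: 2; 6; 4], ([::], [::]));
      ([::], [::], ([:: 0; 5; 2; 6; 1; 3; 4], [::]));
      ([:: 0; 1], [::], ([:: 3; 6; 2; 4], [::]));
      ([::], [::], ([:: 5; 2; 6; 1; 4; 3], [::]));
      ([:: 1], [:: 2; 3], ([:: 4; 0; 5], [::]));
      ([:: 6; 4; 1], [:: 2; 3], ([::], [::]));
      ([::], [:: 2; 0], ([:: 3; 5; 1; 6], [::]));
      ([:: 0; 1], [::], ([:: 3; 4; 2; 5], [::]));
      ([::], [::], ([:: 3; 4; 1; 6; 2; 0; 5], [::]));
      ([:: 0; 1], [:: 2; 5], ([:: 4; 3], [::]));
      ([::], [:: 2; 3; 0], ([:: 5; 1; 4], [::]));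
      ([::], [:: 2; 3; 0], ([:: 4; 1; 6], [::]));
      ([:: 0; 1], [:: 2; 4], ([:: 6; 3], [::]));
      ([:: 5; 0; 1], [:: 2; 3], ([::], [::]));
      ([::], [::], ([:: 6; 2; 4; 1; 3; 5], [::]));
      ([:: 4; 0; 1], [:: 2; 3], ([::], [::]));
      ([:: 0; 1], [:: 2; 3; 4], ([::], [::]));
      ([::], [:: 2; 3], ([:: 4; 1; 5; 0], [::]));
      ([:: 0; 1], [:: 2; 6], ([:: 3; 4], [::]));
      ([:: 3; 0; 1], [::], ([:: 5; 2; 4], [::]));
      ([::], [:: 2; 0], ([:: 5; 1; 4; 3], [::]));
      ([:: 0; 1], [:: 2; 3], ([:: 6; 4], [::]));
      ([::], [:: 2; 3], ([:: 6; 1; 5; 0], [::]));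
      ([::], [::], ([:: 3; 1; 5; 2; 6; 0], [::]));
      ([:: 5; 6; 1], [:: 2; 3], ([::], [::]));
      ([:: 3; 1], [::], ([:: 5; 2; 6; 0], [::]));
      ([:: 4; 6; 1], [:: 2; 3], ([::], [::]));
      ([:: 3; 1], [::], ([:: 4; 2; 6; 0], [::]));
      ([:: 1], [:: 2], ([:: 4; 0; 3; 5], [::]));
      ([:: 1], [:: 2], ([:: 6; 0; 3; 5], [::]));
      ([:: 1], [:: 2], ([:: 6; 3; 0; 4], [::]));
      ([:: 5; 1], [:: 2; 3], ([:: 0; 4], [::]));
      ([:: 3; 1], [::], ([:: 0; 4; 2; 5], [::]));
      ([::], [:: 2; 0], ([:: 3; 6; 1; 5], [::]));
      ([::], [::], ([:: 3; 6; 1; 5; 2; 4], [::]));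
      ([:: 3; 1], [::], ([:: 0; 5; 2; 4], [::]));
      ([:: 3; 1], [::], ([:: 6; 2; 4; 0], [::]));
      ([::], [:: 2; 3], ([:: 4; 1; 6; 0], [::]));
      ([::], [:: 2; 0], ([:: 3; 4; 1; 6], [::]));
      ([::], [::], ([:: 3; 1; 5; 2; 4; 0], [::]));
      ([:: 0; 1], [:: 2; 3], ([:: 5; 6], [::]));
      ([:: 6; 1], [:: 2; 3], ([:: 4; 0], [::]));
      ([:: 1], [:: 2], ([:: 6; 3; 0; 5], [::]));
      ([:: 1], [:: 2], ([:: 5; 0; 3; 4], [::]));
      ([:: 3; 1], [::], ([:: 6; 2; 5; 0], [::]));
      ([:: 0; 1], [:: 2; 4], ([:: 5; 3], [::]));
      ([:: 1], [:: 2], ([:: 6; 0; 3; 4], [::]));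
      ([:: 0; 1], [:: 2; 3], ([:: 4; 5], [::]))].

Lemma long_one_closed : closed_window 7 long_one long_one_improvements.
Proof. by vm_compute. Qed.

Definition three_many : paths := ([:: 0; 1; 2], [::], ([:: 3], [:: 4])).

Definition three_many_improvements : seq paths :=
  [:: ([:: 2; 1], [::], ([:: 5; 0; 3], [:: 4]));
      ([:: 0], [::], ([:: 2; 5; 1; 3], [:: 4]));
      ([:: 4; 6; 1; 0], [::], ([:: 3], [::]));
      ([:: 2; 0], [::], ([:: 5; 1; 3], [:: 4]));
      ([:: 1; 0], [::], ([:: 3], [:: 4; 2; 5]));
      ([:: 0; 1], [::], ([:: 6; 2; 3], [:: 4]));
      ([:: 2], [::], ([:: 6; 1; 3], [:: 4; 0]));
      ([:: 2; 1], [::], ([:: 3], [:: 4; 0; 5]));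
      ([:: 4; 0; 1; 2], [::], ([:: 3], [::]));
      ([:: 0], [::], ([:: 2; 3], [:: 4; 1; 5]));
      ([:: 2], [::], ([:: 0; 3], [:: 4; 1; 5]));
      ([:: 0], [::], ([:: 5; 1; 3], [:: 4; 2]));
      ([:: 0; 1; 6; 3], [::], ([::], [:: 4]));
      ([:: 0; 1; 4; 6], [::], ([:: 3], [::]));
      ([:: 0; 1], [::], ([:: 5; 2; 3], [:: 4]));
      ([:: 2; 1], [::], ([:: 3], [:: 4; 0; 6]));
      ([:: 0; 1; 5; 3], [::], ([::], [:: 4]));
      ([:: 4; 5; 1; 0], [::], ([:: 3], [::]));
      ([:: 0; 1; 4; 5], [::], ([:: 3], [::]));
      ([:: 2], [::], ([:: 0; 5; 1; 3], [:: 4]));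
      ([:: 3; 2; 1; 0], [::], ([::], [:: 4]));
      ([:: 0], [::], ([:: 2; 3], [:: 4; 1; 6]));
      ([:: 2], [::], ([:: 3], [:: 4; 1; 6; 0]));
      ([:: 0], [::], ([:: 6; 1; 3], [:: 4; 2]));
      ([:: 6; 5], [::], ([:: 1; 3], [:: 4; 0]));
      ([:: 5], [::], ([:: 1; 3], [:: 4; 0; 2]));
      ([:: 2], [::], ([:: 0; 3], [:: 4; 1; 6]));
      ([:: 0; 1; 3; 6], [::], ([::], [:: 4]));
      ([:: 3; 0; 1; 2], [::], ([::], [:: 4]));
      ([:: 5; 3; 1; 0], [::], ([::], [:: 4]));
      ([:: 1; 0], [::], ([:: 3], [:: 4; 2; 6]));
      ([:: 2; 1], [::], ([:: 6; 0; 3], [:: 4]));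
      ([:: 0; 1; 5], [::], ([:: 2; 3], [:: 4]));
      ([:: 4; 2; 1; 0], [::], ([:: 3], [::]));
      ([:: 6; 1; 0], [::], ([:: 2; 3], [:: 4]));
      ([:: 2; 1; 0; 5], [::], ([:: 3], [::]));
      ([:: 5; 1; 2], [::], ([:: 0; 3], [:: 4]));
      ([:: 6; 0; 1; 2], [::], ([:: 3], [::]));
      ([:: 0; 1; 2; 5], [::], ([:: 3], [::]));
      ([:: 0], [::], ([:: 6; 5; 1; 3], [:: 4]));
      ([:: 0], [::], ([:: 3], [:: 4; 1; 5; 2]));
      ([:: 0; 1; 2], [::], ([:: 6; 3], [:: 4]));
      ([:: 0; 1; 2], [::], ([:: 5; 3], [:: 4]));
      ([:: 0; 1; 2], [::], ([:: 3], [:: 4; 6]));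
      ([:: 2; 1; 0], [::], ([:: 3], [:: 4; 5]));
      ([:: 0; 1; 2; 6], [::], ([:: 3], [::]))].

Lemma three_many_closed : closed_window 7 three_many three_many_improvements.
Proof. by vm_compute. Qed.

(** For one blue vertex and at least three uncovered ones, of which 3, 4 and 5 are visible. *)
Definition many_one : paths := ([:: 0], [:: 1], ([:: 2], [::])).

Definition many_one_improvements : seq paths :=
  [:: ([::], [:: 1], ([:: 4; 0; 3], [::]));
      ([::], [:: 1], ([:: 4; 0; 2], [::]));
      ([:: 0], [::], ([:: 5; 1; 2], [::])); ([:: 4; 0], [:: 1], ([::], [::]));
      ([:: 0], [::], ([:: 5; 1; 3], [::]));
      ([::], [:: 1], ([:: 5; 0; 3], [::]));
      ([:: 0], [::], ([:: 3; 1; 4], [::]));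
      ([:: 0], [::], ([:: 2; 1; 3], [::]));
      ([::], [:: 1], ([:: 2; 0; 3], [::]));
      ([::], [:: 1], ([:: 5; 0; 2], [::])); ([:: 0], [:: 1; 5], ([::], [::]));
      ([::], [:: 1], ([:: 4; 0; 5], [::]));
      ([:: 0], [::], ([:: 5; 1; 4], [::])); ([:: 2; 0], [:: 1], ([::], [::]));
      ([:: 0], [:: 1; 3], ([::], [::])); ([:: 5; 0], [:: 1], ([::], [::]));
      ([:: 0], [:: 1; 4], ([::], [::])); ([:: 0], [:: 1; 2], ([::], [::]));
      ([:: 3; 0], [:: 1], ([::], [::])); ([:: 0], [::], ([:: 2; 1; 4], [::]))].

Lemma many_one_closed : closed_window 6 many_one many_one_improvements.
Proof. by vm_compute. Qed.

Definition two_three : paths := ([:: 0; 1], [::], ([:: 2; 3], [:: 4])).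

Definition two_three_improvements : seq paths :=
  [:: ([:: 1], [::], ([:: 5; 0; 2; 3], [:: 4]));
      ([:: 3; 6; 2], [::], ([::], [:: 4; 1]));
      ([:: 2; 1; 0], [::], ([:: 3], [:: 4]));
      ([:: 0], [::], ([:: 5; 1; 2; 3], [:: 4]));
      ([:: 1], [::], ([:: 2; 3], [:: 4; 0; 6]));
      ([:: 2], [::], ([:: 1; 6; 3], [:: 4; 0]));
      ([:: 1], [::], ([:: 6; 0; 2; 3], [:: 4]));
      ([:: 6; 2; 5], [::], ([:: 3], [:: 4]));
      ([:: 0], [::], ([:: 6; 1; 2; 3], [:: 4]));
      ([:: 6; 4; 5], [::], ([:: 2; 3], [::]));
      ([:: 5; 3; 6; 2], [::], ([::], [:: 4]));
      ([:: 2], [::], ([:: 6; 1; 3], [:: 4; 0]));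
      ([:: 6; 3; 5; 2], [::], ([::], [:: 4]));
      ([:: 0], [::], ([:: 2; 3], [:: 4; 1; 6]));
      ([:: 1; 0; 6], [::], ([:: 2; 3], [::]));
      ([:: 1], [::], ([:: 2; 3], [:: 4; 0; 5]));
      ([:: 3; 5; 2], [::], ([::], [:: 4; 1]));
      ([:: 1], [::], ([:: 5; 3], [:: 4; 0; 2]));
      ([:: 1; 0], [::], ([:: 6; 5; 3], [:: 4]));
      ([:: 0], [::], ([:: 2; 3], [:: 4; 1; 5]));
      ([:: 1; 0], [::], ([:: 5; 6; 3], [:: 4]));
      ([:: 5; 0; 1], [::], ([:: 2; 3], [::]));
      ([:: 4; 1; 0], [::], ([:: 2; 3], [::]));
      ([:: 1; 0], [::], ([:: 5; 2; 3], [:: 4]));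
      ([:: 0; 1], [::], ([:: 2; 3], [:: 4; 6]));
      ([:: 1], [::], ([:: 6; 5; 0; 3], [:: 4]));
      ([:: 0; 1], [::], ([:: 6; 2; 3], [:: 4]));
      ([:: 2], [::], ([:: 6; 0; 3], [:: 4; 1]));
      ([:: 2], [::], ([:: 0; 5; 3], [:: 4; 1]));
      ([:: 0; 1; 3; 6], [::], ([::], [:: 4]));
      ([:: 0], [::], ([:: 6; 5; 1; 3], [:: 4]));
      ([:: 2], [::], ([:: 0; 6; 3], [:: 4; 1]));
      ([:: 2; 5; 6], [::], ([:: 3], [:: 4]));
      ([:: 2; 6; 5], [::], ([:: 3], [:: 4]));
      ([:: 0; 1; 3; 5], [::], ([::], [:: 4]));
      ([:: 6; 1; 0], [::], ([:: 2; 3], [::]));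
      ([:: 1; 0; 2], [::], ([:: 3], [:: 4]));
      ([:: 1; 0; 3; 5], [::], ([::], [:: 4]));
      ([:: 4; 0; 1], [::], ([:: 2; 3], [::]));
      ([:: 1; 0; 3; 6], [::], ([::], [:: 4]));
      ([:: 0; 1; 5], [::], ([:: 2; 3], [::]));
      ([:: 1; 0], [::], ([:: 2; 3], [:: 4; 5]))].

Lemma two_three_closed : closed_window 7 two_three two_three_improvements.
Proof. by vm_compute. Qed.

(** Both paths are entirely visible. Since $n \ge 7$, three uncovered vertices 4, 5 and 6 exist. *)
Definition two_two : paths := ([:: 0; 1], [::], ([:: 2; 3], [::])).

Definition two_two_improvements : seq paths :=
  [:: ([:: 2; 6; 3], [::], ([:: 0], [::]));
      ([:: 1], [::], ([:: 4; 0; 3; 2], [::]));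
      ([:: 3; 5; 2], [::], ([:: 0], [::]));
      ([:: 1], [::], ([:: 5; 0; 3; 2], [::]));
      ([:: 0], [::], ([:: 4; 1; 3; 2], [::]));
      ([:: 1], [::], ([:: 6; 0; 2; 3], [::]));
      ([:: 0], [::], ([:: 5; 1; 3; 2], [::]));
      ([:: 0], [::], ([:: 5; 1; 2; 3], [::]));
      ([:: 1; 0; 2], [::], ([:: 3], [::]));
      ([:: 1], [::], ([:: 2; 3; 0; 6], [::]));
      ([:: 1], [::], ([:: 3; 2; 0; 5], [::]));
      ([:: 4; 3; 6], [::], ([:: 0], [::]));
      ([:: 0], [::], ([:: 4; 1; 2; 3], [::]));
      ([:: 1], [::], ([:: 3; 2; 0; 4], [::]));
      ([:: 5; 1; 0], [::], ([:: 2], [::]));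
      ([:: 4; 1; 0], [::], ([:: 2], [::]));
      ([:: 4; 3; 5], [::], ([:: 0], [::]));
      ([:: 0], [::], ([:: 6; 1; 3; 2], [::]));
      ([:: 1; 0; 3], [::], ([:: 2], [::]));
      ([:: 0], [::], ([:: 3; 2; 1; 6], [::]));
      ([:: 0; 1], [::], ([:: 2; 3; 4], [::]));
      ([:: 1; 0], [::], ([:: 5; 3; 2], [::]));
      ([:: 1; 0], [::], ([:: 6; 3; 2], [::]));
      ([:: 0; 1; 6], [::], ([:: 2], [::]));
      ([:: 5; 0; 1], [::], ([:: 2], [::]));
      ([:: 1; 0; 4], [::], ([:: 2], [::]));
      ([:: 0; 1], [::], ([:: 3; 2; 6], [::]));
      ([:: 2; 1; 0], [::], ([:: 3], [::]));
      ([:: 3; 1; 0], [::], ([:: 2], [::]));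
      ([:: 6; 0; 1], [::], ([:: 2], [::]));
      ([:: 0; 1], [::], ([:: 3; 2; 5], [::]))].

Lemma two_two_closed : closed_window 7 two_two two_two_improvements.
Proof. by vm_compute. Qed.

Definition one_many : paths := ([:: 0], [::], ([:: 1], [:: 2])).

Definition one_many_improvements : seq paths :=
  [:: ([:: 2; 3], [::], ([:: 1], [::])); ([:: 0], [::], ([:: 1], [:: 2; 4]));
      ([:: 3; 1], [::], ([::], [:: 2])); ([:: 1; 4], [::], ([::], [:: 2]));
      ([:: 0], [::], ([:: 3; 1], [:: 2])); ([:: 2; 4], [::], ([:: 1], [::]));
      ([:: 0], [::], ([:: 4; 1], [:: 2])); ([:: 0], [::], ([:: 1], [:: 2; 3]))].

Lemma one_many_closed : closed_window 5 one_many one_many_improvements.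
Proof. by vm_compute. Qed.

Definition one_one : paths := ([:: 0], [::], ([:: 1], [::])).

Definition one_one_improvements : seq paths :=
  [:: ([:: 1], [::], ([:: 2; 0], [::])); ([:: 0; 2], [::], ([::], [::]));
      ([:: 1; 2], [::], ([::], [::])); ([:: 1], [::], ([:: 0; 3], [::]));
      ([:: 1; 3], [::], ([::], [::])); ([:: 0], [::], ([:: 2; 1], [::]));
      ([:: 3; 0], [::], ([::], [::])); ([:: 0], [::], ([:: 3; 1], [::]))].

Lemma one_one_closed : closed_window 4 one_one one_one_improvements.
Proof. by vm_compute. Qed.

(** * Soundness of a closed window *)

Section Windows.

Variables (T : finType) (e : rel T) (c : edge_coloring T).
Hypothesis e_simple : simple_graph e.
Hypothesis compl_C4_free : ~ has_C4 (compl_graph e).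

Definition status (x y : T) : option color :=
  if e x y then Some (c [set x; y]) else None.

Lemma statusC x y : status x y = status y x.
Proof. by rewrite /status e_simple.1 setUC. Qed.

Lemma color_classE a x y : color_class e c a x y = (status x y == Some a).
Proof. by rewrite /color_class /status /=; case: ifP. Qed.

Definition disjoint_paths (p q : seq T) :=
  [&& sorted (color_class e c red) p, sorted (color_class e c blue) q
    & uniq (p ++ q)].

Definition improvable (p q : seq T) :=
  exists p' q', disjoint_paths p' q' /\
    lex_lt (size p) (size q) (size p') (size q').

(** The label [i] denotes entry [i] of [loc]; [B] and [D] are the hidden middles of the red and the
    blue path. *)
Variables (x0 : T) (loc B D : seq T).
Hypothesis uniq_all : uniq (loc ++ B ++ D).

Let f := nth x0 loc.
Let v (ij : nat * nat) : option color := status (f ij.1) (f ij.2).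

Definition realize (E : ends) (s : seq T) :=
  map (nth x0 loc) E.1 ++ s ++ map (nth x0 loc) E.2.

Lemma edge_lits_sorted a s :
  all (fun l => v l.1 == l.2) (edge_lits a s) =
  sorted (fun i j => status (f i) (f j) == a) s.
Proof.
case: s => // i s; rewrite /= /edge_lits /=.
elim: s i => //= j s IHs i; rewrite IHs; congr (_ && _).
by rewrite /v /= /minn /maxn; case: ifP => // _; rewrite statusC.
Qed.

Lemma sorted_edge_lits a s :
  all (fun l => v l.1 == l.2) (edge_lits (Some a) s) =
  sorted (color_class e c a) (map f s).
Proof.
rewrite edge_lits_sorted sorted_map; apply: eq_sorted => i j /=.
by rewrite -color_classE.
Qed.

Lemma paths_litsP K :
  all (fun l => v l.1 == l.2) (paths_lits K) =
  [&& sorted (color_class e c red) (map f K.1.1),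
      sorted (color_class e c red) (map f K.1.2),
      sorted (color_class e c blue) (map f K.2.1)
    & sorted (color_class e c blue) (map f K.2.2)].
Proof. by rewrite /paths_lits !all_cat !sorted_edge_lits. Qed.

Lemma realize_sorted (r : rel T) E E' s :
  extends_middle E E' -> (nilp E.2 -> nilp s) -> sorted r (realize E s) ->
  sorted r (map f E'.1) -> sorted r (map f E'.2) -> sorted r (realize E' s).
Proof.
case: E E' => [l t] [l' t']; rewrite /extends_middle /realize /=.
case: t => [|y t] /=.
  by move=> /nilP-> /(_ isT)/nilP->; rewrite /= !cats0.
case/and3P=> l0 /eqP ll' /eqP tt' _ rlst rl' rt'.
apply: (@sorted_cat_replace_left _ _ x0 (map f l)) => //.
- by case: (l) l0.
- rewrite catA; apply: (@sorted_cat_replace_right _ _ (f y) _ (map f t)) => //.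
    by rewrite -catA.
  by case: (t') tt' => //= ? ? ->.
- case: (l) (l') l0 ll' => [|i l1] // l2 _.
  by rewrite /= last_map last_map => ->.
Qed.

(** Labels below [size loc] name distinct vertices, so four such non-edges would form a $C_4$ in the
    complement. *)
Lemma four_cycles_unrefuted s :
  s \in four_cycles (size loc) ->
  all (fun l => v l.1 == l.2) (edge_lits None (rcons s (head 0 s))) -> False.
Proof.
rewrite mem_filter => /andP[/andP[us _]] /allpairsP[[x y] [/= xin yin es]].
rewrite edge_lits_sorted es /= => /and5P[ab bc cd da _]; apply: compl_C4_free.
have in_loc z : z \in [:: x.1; y.1; x.2; y.2] -> z < size loc.
  have lt2 w : w \in [seq ij <- [seq (i, j) | i <- iota 0 (size loc),
      j <- iota 0 (size loc)] | ij.1 < ij.2] ->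
      w.1 < size loc /\ w.2 < size loc.
    rewrite mem_filter => /andP[_ /allpairsP[[i j] [/=]]].
    by rewrite !mem_iota => ? ? ->.
  have [? ?] := lt2 _ xin; have [? ?] := lt2 _ yin.
  by rewrite !inE => /or4P[] /eqP->.
have uf : uniq (map f [:: x.1; y.1; x.2; y.2]).
  rewrite map_inj_in_uniq -?es // es => i j /in_loc ilt /in_loc jlt /eqP.
  rewrite nth_uniq //; first by move/eqP.
  by move: uniq_all; rewrite cat_uniq => /and3P[].
exists (map f [:: x.1; y.1; x.2; y.2]) => //.
have none z w : status z w == None -> ~~ e z w by rewrite /status; case: ifP.
rewrite /ucycleb uf andbT /compl_graph /= !none // !andbT.
move: uf; rewrite /= !inE !negb_or => /and4P[/and3P[-> _ n] /andP[-> _] -> _].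
by rewrite eq_sym n.
Qed.

(** Up to order, the two paths consist of the vertices labelled by [labels K] and the blocks. Labels
    inject into [loc], which is disjoint from the blocks. *)
Lemma realize_uniq K :
  uniq (labels K) -> all (gtn (size loc)) (labels K) ->
  uniq (realize K.1 B ++ realize K.2 D).
Proof.
move=> uK ltK.
have permK : perm_eq (realize K.1 B ++ realize K.2 D)
    (map f (labels K) ++ B ++ D).
  rewrite /realize /labels !map_cat -/f; apply/permP => P; rewrite !count_cat.
  by clear; lia.
have [uloc hasN uBD] : [/\ uniq loc, ~~ has (mem loc) (B ++ D) & uniq (B ++ D)].
  by apply/and3P; rewrite -cat_uniq.
rewrite (perm_uniq permK) cat_uniq uBD andbT; apply/andP; split.
  rewrite map_inj_in_uniq // => i j /(allP ltK) ilt /(allP ltK) jlt /eqP.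
  by rewrite nth_uniq // => /eqP.
apply: contra hasN => /hasP[z zBD /mapP[i /(allP ltK) ilt ez]].
by apply/hasP; exists z => //; rewrite ez; apply: mem_nth.
Qed.

(** Apply [refuteP] with improvability itself as the goal [G] and the actual states of the pairs as
    the assignment. *)
Lemma closed_window_improvable K imps :
  closed_window (size loc) K imps ->
  (nilp K.1.2 -> nilp B) -> (nilp K.2.2 -> nilp D) ->
  disjoint_paths (realize K.1 B) (realize K.2 D) ->
  improvable (realize K.1 B) (realize K.2 D).
Proof.
case/andP=> /allP imps_ok ref nB nD /and3P[rp bq upq].
have := refuteP (f := v) _ ref; apply.
  by move=> ij; rewrite /v /status; case: ifP => // _; case: (c _).
have: all (fun l => v l.1 == l.2) (paths_lits K).
  rewrite paths_litsP; move: rp bq; rewrite /realize.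
  by do 2![move=> /cat_sorted2[-> /cat_sorted2[_ ->]]].
(* A true rerouting clause yields the better pair of paths; a true 4-cycle clause is absurd. *)
have: entails_goal v (improvable (realize K.1 B) (realize K.2 D))
  ([seq paths_lits K' | K' <- imps] ++
   [seq edge_lits None (rcons s (head 0 s)) | s <- four_cycles (size loc)]).
  move=> cl; rewrite mem_cat => /orP[] /mapP[].
    move=> K' /imps_ok/and5P[uK' ltK' ext1 ext2 lt] ->.
    rewrite paths_litsP => /and4P[r1 r2 b1 b2].
    exists (realize K'.1 B), (realize K'.2 D); split.
      rewrite /disjoint_paths realize_uniq // andbT.
      by rewrite (realize_sorted ext1) // (realize_sorted ext2).
    rewrite /realize !size_cat !size_map; apply: lex_ltD.
    by rewrite -!size_cat.
  by move=> s s4 -> /(four_cycles_unrefuted s4).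
(* The edges of [K] are true literals, so assigning them one by one preserves entailment. *)
elim: (paths_lits K) (_ ++ _) => //= l ls IHls cls clsG /andP[/eqP vl vls].
exact: IHls (entails_assign vl clsG) vls.
Qed.

End Windows.

(** * Choosing a window and maximizing *)

Lemma size_ge2_rcons2 (T : Type) (s : seq T) :
  2 <= size s -> exists s' x y, s = s' ++ [:: x; y].
Proof.
case/lastP: s => // s y; case/lastP: s => // s x _.
by exists s, x, y; rewrite -!cats1 -catA.
Qed.

(** This reduces distinctness of rearranged vertices to an inequality of counts, which [lia] can
    settle. *)
Lemma uniq_le_count (T : eqType) (s1 s2 : seq T) :
  uniq s2 -> (forall x, count_mem x s1 <= count_mem x s2) -> uniq s1.
Proof.
move=> us2 le12; apply: count_mem_uniq => x; have := le12 x.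
rewrite (count_uniq_mem _ us2) -[x \in s1]has_pred1 has_count.
by case: (x \in s2); case: (count_mem x s1) => [|[|k]].
Qed.

(* The indicator values [P x] are generalized because [lia] would otherwise
   split on each of these booleans. *)
Ltac count_le :=
  move=> P; rewrite /= ?count_cat /= ?count_cat /=; clear;
  do ?[move: (nat_of_bool _) => ?]; lia.

Section Improvement.

Variables (T : finType) (e : rel T) (c : edge_coloring T).
Hypothesis e_simple : simple_graph e.
Hypothesis compl_C4_free : ~ has_C4 (compl_graph e).

Lemma improvable_window (x0 : T) (loc B D : seq T) K imps (p q us : seq T) :
  closed_window (size loc) K imps -> uniq (p ++ q ++ us) ->
  disjoint_paths e c p q ->
  (nilp K.1.2 -> nilp B) -> (nilp K.2.2 -> nilp D) ->
  realize x0 loc K.1 B = p -> realize x0 loc K.2 D = q ->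
  (forall P, count P (loc ++ B ++ D) <= count P (p ++ q ++ us)) ->
  improvable e c p q.
Proof.
move=> ok upq pq nB nD ep eq_q le_count; rewrite -ep -eq_q in pq *.
apply: closed_window_improvable ok nB nD pq => //.
exact: uniq_le_count upq _.
Qed.

(** An empty path is replaced by one uncovered vertex. Otherwise the lengths of [p] and [q] and the
    number of uncovered vertices select one of the eight windows. *)
Lemma improvable_uncovered (p q us : seq T) :
  uniq (p ++ q ++ us) -> 7 <= size (p ++ q ++ us) -> 2 <= size us ->
  disjoint_paths e c p q -> improvable e c p q.
Proof.
case: us => [|u [|w us]] // upq sz _ pq.
have [p0|p_gt0] := posnP (size p).
  exists [:: u], q; rewrite (size0nil p0) in upq pq *.
  split; last by rewrite /lex_lt /= add0n add1n ltnSn.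
  case/and3P: pq => _ sq _; apply/and3P; split=> //.
  by apply: uniq_le_count upq _ => x; rewrite /= !count_cat /=; lia.
have [q0|q_gt0] := posnP (size q).
  exists p, [:: u]; rewrite (size0nil q0) in upq pq *.
  split; last by rewrite /lex_lt /= addn0 addn1 ltnSn.
  case/and3P: pq => sp _ _; apply/and3P; split=> //.
  by apply: uniq_le_count upq _ => x; rewrite /= !count_cat /=; lia.
case: q q_gt0 upq sz pq => // y1 q _; case: p p_gt0 => // x1 p _ upq sz pq.
have [q0|] := posnP (size q); last first.
  case/lastP: q upq sz pq => // D y2 upq sz pq _; rewrite -cats1 in upq sz pq *.
  case: p upq sz pq => [|x2 [|x3 p]] upq sz pq.
  - apply: (improvable_window (x0 := u) (loc := [:: x1; y1; y2; u; w])
      (B := [::]) (D := D) one_many_closed upq pq) => //.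
    count_le.
  - case: D upq sz pq => [|y3 D] upq sz pq.
      (* Two red and two blue vertices leave at least three of the seven uncovered. *)
      case: us upq sz => [|z us] upq sz; first by move: sz.
      apply: (improvable_window (x0 := u) (loc := [:: x1; x2; y1; y2; u; w; z])
        (B := [::]) (D := [::]) two_two_closed upq pq) => //.
      count_le.
    apply: (improvable_window (x0 := u) (loc := [:: x1; x2; y1; y3; y2; u; w])
      (B := [::]) (D := D) two_three_closed upq pq) => //.
    count_le.
  - case: p upq sz pq => [|x4 p] upq sz pq.
      apply: (improvable_window (x0 := u) (loc := [:: x1; x2; x3; y1; y2; u; w])
        (B := [::]) (D := D) three_many_closed upq pq) => //.
      count_le.
    have [B [x5 [x6 eB]]] := size_ge2_rcons2 (isT : 2 <= size [:: x3, x4 & p]).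
    rewrite eB in upq pq *.
    apply: (improvable_window (x0 := u)
      (loc := [:: x1; x2; x5; x6; y1; y2; u; w]) (B := B) (D := D)
      long_many_closed upq pq) => //.
    count_le.
rewrite (size0nil q0) in upq sz pq *.
case: us upq sz => [|z us] upq sz.
  (* One blue and two uncovered vertices force at least four red ones. *)
  case: p upq sz pq => [|x2 [|x3 [|x4 p]]] upq sz pq; try by move: sz.
  have [B [x5 [x6 eB]]] := size_ge2_rcons2 (isT : 2 <= size [:: x3, x4 & p]).
  rewrite eB in upq pq *.
  apply: (improvable_window (x0 := u) (loc := [:: x1; x2; x5; x6; y1; u; w])
    (B := B) (D := [::]) long_one_closed upq pq) => //.
  count_le.
case/lastP: p upq sz pq => [|B x2] upq sz pq.
  apply: (improvable_window (x0 := u) (loc := [:: x1; y1; u; w])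
    (B := [::]) (D := [::]) one_one_closed upq pq) => //.
  count_le.
rewrite -cats1 in upq pq *.
apply: (improvable_window (x0 := u) (loc := [:: x1; x2; y1; u; w; z])
  (B := B) (D := [::]) many_one_closed upq pq) => //.
count_le.
Qed.

(** Improve repeatedly until at most one vertex is uncovered. This stops because a bounded integer
    weight grows each time. *)
Lemma covering_paths (p q : seq T) :
  7 <= #|T| -> disjoint_paths e c p q ->
  exists p' q', disjoint_paths e c p' q' /\ #|T| - 1 <= size (p' ++ q').
Proof.
(* The factor exceeds every possible [size p], so [weight] turns the lexicographic order into that
   of the integers. *)
move=> T7; pose weight (p q : seq T) := size (p ++ q) * #|T|.+1 + size p.
have [n] := ubnP (#|T| * #|T|.+1 + #|T| - weight p q).
elim: n p q => // n IHn p q lt_n pq.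
have [_ _ upq] := and3P pq.
have [|few] := leqP (#|T| - 1) (size (p ++ q)); first by exists p, q.
pose us := enum [pred x | x \notin p ++ q].
have us_uniq : uniq (p ++ q ++ us).
  rewrite catA cat_uniq upq enum_uniq andbT.
  by apply/hasPn => x; rewrite mem_enum.
have us_size : size (p ++ q ++ us) = #|T|.
  rewrite -(card_uniqP us_uniq); apply: eq_card => x.
  by rewrite catA mem_cat mem_enum inE orbN.
have us2 : 2 <= size us by move: us_size few; rewrite catA size_cat; lia.
have [|p' [q' [pq' lt']]] := improvable_uncovered us_uniq _ us2 pq.
  by rewrite us_size.
apply: IHn (pq'); rewrite ltnS in lt_n; apply: leq_trans lt_n.
have le_T (s : seq T) : uniq s -> size s <= #|T|.
  by move=> /card_uniqP<-; apply: max_card.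
have [_ _ upq'] := and3P pq'.
have le_p : size p <= #|T|.
  by apply: le_T; move: upq; rewrite cat_uniq => /and3P[].
have le_p' : size p' <= #|T|.
  by apply: le_T; move: upq'; rewrite cat_uniq => /and3P[].
(* This bound keeps the truncated subtraction in the induction measure from hiding the increase. *)
have le_weight : weight p' q' <= #|T| * #|T|.+1 + #|T|.
  by rewrite leq_add // leq_mul2r le_T ?orbT.
suff lt_weight : weight p q < weight p' q' by lia.
rewrite /weight !size_cat; case/orP: lt' => [lt_sum|/andP[/eqP-> lt_p]].
  apply: leq_trans (leq_addr _ _).
  apply: leq_trans (_ : (size p + size q).+1 * #|T|.+1 <= _).
    by rewrite mulSn addnC ltn_add2r ltnS.
  by rewrite leq_mul2r lt_sum orbT.
by rewrite ltn_add2l.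
Qed.

End Improvement.

Theorem theorem26 (n : nat) (T : finType) (e : rel T) (c : edge_coloring T)
    (Hn : 7 <= n) (HT : #|T| = n) (He : simple_graph e)
    (HC4 : ~ has_C4 (compl_graph e)) :
  exists p q : seq T,
    [/\ monochromatic_path e c red p,
        monochromatic_path e c blue q,
        [disjoint p & q]
      & n - 1 <= #|[set x | (x \in p) || (x \in q)]|].
Proof.
rewrite -HT in Hn *.
(* The improvements start from two empty paths. *)
have [p [q [/and3P[sp sq upq] cov]]] :=
  covering_paths He HC4 Hn (isT : disjoint_paths e c [::] [::]).
exists p, q; move: (upq); rewrite cat_uniq => /and3P[up pq uq].
split; rewrite /monochromatic_path ?sp ?sq //.
  by rewrite disjoint_sym disjoint_has.
suff -> : #|[set x | (x \in p) || (x \in q)]| = size (p ++ q) by [].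
by rewrite -(card_uniqP upq); apply: eq_card => x; rewrite inE mem_cat.
Qed.
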